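(* Let $H$ be a real Hilbert space, $F:H\to H$, $\Phi:H\to H$, let $y\in H$ with $F(y)=0$, and let $\rho,M_1,M_2,m_1,c_1,c_2,L_1>0$ be constants. Let $c$ be a constant with $0<c<c_1$. Then there exist $\eta>0$ and $h_0>0$ such that the following holds for every $h\in(0,h_0]$ and every $u_0\in H$ with $\|u_0-y\|\le\eta$ (that is, for $h>0$ sufficiently small and $u_0$ sufficiently close to $y$) for which, with $B(v,\rho):=\{u\in H:\|u-v\|\le\rho\}$: - $y\in B(u_0,\rho)$, and $F$ has Fréchet derivatives on $B(u_0,\rho)$ with $\sup_{u\in B(u_0,\rho)}\|F^{(j)}(u)\|\le M_j$, $j=1,2$; - $\sup_{u\in B(u_0,\rho)}\|[F'(u)]^{-1}\|\le m_1$; - $(F'(u)\Phi(u),F(u))\le -c_1\|F(u)\|^2$ and $\|\Phi(u)\|\le c_2\|F(u)\|$ for all $u\in B(u_0,\rho)$; - $\frac{c_2}{c_1}\|F(u_0)\|\le\rho$; - $\Phi$ is Fréchet differentiable on $B(y,\rho)$ with $\|\Phi'(u)\|\le L_1$ for $u\in B(y,\rho)$. The sequence defined by $u_{n+1}=u_n+h\Phi(u_n)$, $n\ge0$, starting from $u_0$, satisfies for all $n\ge0$ $$\|u_n-y\|\le Re^{-chn},\qquad \|F(u_n)\|\le\|F_0\|e^{-chn},$$ where $F_0:=F(u_0)$ and $R:=\frac{c_2\|F_0\|}{c_1}$.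
   Context: $(\cdot,\cdot)$ and $\|\cdot\|$ are the inner product and norm of $H$; operators are given operator norms. The scheme is the discretization with step $h$ of the Cauchy problem $\dot u=\Phi(u)$, $u(0)=u_0$, with $\Phi$ not depending explicitly on time. As in the paper's standing assumptions, $\Phi$ is locally Lipschitz. *)

(* Defs.v *)
From HB Require Import structures.
From mathcomp Require Import all_boot all_order all_algebra sesquilinear.
From mathcomp Require Import all_classical all_reals all_analysis.

Set Implicit Arguments.
Unset Strict Implicit.
Unset Printing Implicit Defensive.

Import Order.TTheory GRing.Theory Num.Theory.
Import numFieldNormedType.Exports.

Local Open Scope classical_set_scope.
Local Open Scope ring_scope.

(* A real Hilbert space is a complete normed module H over R together with a
   positive definite symmetric bilinear form dot inducing its norm. *)
Definition induces_norm (R : realType) (H : normedModType R)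
    (dot : {dot H for idfun}) : Prop :=
  forall u : H, dot u u = `|u| ^+ 2.

(* These norms take values in \bar R, so that an unbounded map gets +oo. *)
Definition op_norm (R : realType) (H : normedModType R) (A : H -> H) : \bar R :=
  ereal_sup [set (`|A v|)%:E | v in [set v : H | `|v| <= 1]].

(* The norm of v |-> D v as an element of L(H, L(H, H)). *)
Definition bilin_norm (R : realType) (H : normedModType R)
    (D : H -> H -> H) : \bar R :=
  ereal_sup [set op_norm (D v) | v in [set v : H | `|v| <= 1]].

(* D is the second Frechet derivative of F at u: the derivative at u of the map
   x |-> 'd F x from B to L(H, H) with the operator norm. As 'd F is meaningful
   only where F is differentiable, x is kept in B; at an interior point of B
   this is no restriction. *)
Definition is_diff2_within (R : realType) (H : normedModType R) (B : set H)
    (F : H -> H) (u : H) (D : {bilinear H -> H -> H}) : Prop :=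
  (bilin_norm D < +oo)%E /\
  forall e : R, 0 < e -> \forall x \near within B (nbhs u),
    (op_norm (fun v => 'd F x v - 'd F u v - D (x - u) v)%R
       <= (e * `|x - u|)%:E)%E.

Definition diff_bounded_on (R : realType) (H : normedModType R) (B : set H)
    (F : H -> H) (M : R) : Prop :=
  (forall u, B u -> differentiable F u) /\
  (ereal_sup [set op_norm ('d F u) | u in B] <= M%:E)%E.

Definition diff2_bounded_on (R : realType) (H : normedModType R) (B : set H)
    (F : H -> H) (M : R) : Prop :=
  exists D2 : H -> {bilinear H -> H -> H},
    (forall u, B u -> is_diff2_within B F u (D2 u)) /\
    (ereal_sup [set bilin_norm (D2 u) | u in B] <= M%:E)%E.

Definition diff_inverse_bounded_on (R : realType) (H : normedModType R)
    (B : set H) (F : H -> H) (m : R) : Prop :=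
  exists G : H -> {linear H -> H},
    (forall u, B u -> cancel ('d F u) (G u) /\ cancel (G u) ('d F u)) /\
    (ereal_sup [set op_norm (G u) | u in B] <= m%:E)%E.

Definition locally_lipschitz (R : realType) (H : normedModType R)
    (Phi : H -> H) : Prop :=
  forall u : H, lipschitz_on Phi (nbhs (u, u)).

Fixpoint euler (R : realType) (H : normedModType R) (Phi : H -> H) (h : R)
    (u0 : H) (n : nat) : H :=
  if n is n'.+1 then
    euler Phi h u0 n' + h *: Phi (euler Phi h u0 n')
  else u0.

(* Main.v *)
Require Import Defs.
From HB Require Import structures.
From mathcomp Require Import all_boot all_order all_algebra sesquilinear.
From mathcomp Require Import all_classical all_reals all_analysis.
From mathcomp Require Import ring lra.

Set Implicit Arguments.
Unset Strict Implicit.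
Unset Printing Implicit Defensive.

Import Order.TTheory GRing.Theory Num.Theory.
Import numFieldNormedType.Exports.

Local Open Scope classical_set_scope.
Local Open Scope ring_scope.

(** Everything is read off from the residual `|F v|.  Put
      S := {v | `|v - y| <= delta, `|F v| <= eps}
    with delta, eps small.  For k < c1, one Euler step of a length h below a
    threshold depending only on k and the constants maps S into S and satisfies
      `|F (v + h Phi v)| <= (1 - k h) `|F v|:                           (i)
    by Taylor, F (v + h Phi v) is F v + h F'(v) Phi(v) up to O(h^2 `|F v|^2),
    and the dissipation hypothesis bounds the inner product of the two terms
    (dissipative_step, residual_decay).  The step cannot leave S, because
    `|v - y| <= 2 m1 `|F v| near y (zero_error_bound), so that a small residual
    brings v back within delta of y.  With k = c, (i) gives the decay of the
    residuals, as 1 - c h <= exp (- c h).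

    The bound on the distance needs the sharp constant in
      `|v - y| <= c2 / c1 `|F v|   for v in S,                          (ii)
    whose right-hand side bounds the length of the trajectory of the flow of Phi
    from v to y.  The flow can be avoided: any constant a valid in (ii) on the
    whole of S can be replaced by a (1 - k h) + h c2, by taking one auxiliary
    Euler step, since S is stable and a step has length at most
    h c2 `|F v|.  Repeating this from a = 2 m1 gives constants converging to
    c2 / k (decay_error_bound), and k may tend to c1.  Applying (ii) to u_n and the decay to `|F u_n| concludes.

    The calculus rests on one mean value inequality, for maps into a normed
    space (pointwise_lipschitz_segment).  It is stated for pointwise Lipschitz
    bounds rather than derivatives so that it also applies to x |-> 'd F x w,
    which is differentiable only relatively to the ball. *)

(** * Mean value inequality and Taylor bound *)

(** For e > 0, the set of the t such that `|g t - g 0| <= (L + e) t contains its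
    supremum s, and contains points beyond s if s < 1. *)
Lemma pointwise_lipschitz_unit (R : realType) (V : normedModType R)
    (g : R -> V) (L : R) :
    (forall t e : R, 0 <= t -> t <= 1 -> 0 < e ->
       \forall s \near t, `|g s - g t| <= (L + e) * `|s - t|) ->
  `|g 1 - g 0| <= L.
Proof.
move=> lipg; apply/ler_addgt0Pr => e e0.
pose S := [set t | [/\ 0 <= t, t <= 1 & `|g t - g 0| <= (L + e) * t]].
have S0 : S 0 by split; rewrite // subrr normr0 mulr0.
have ubS : has_ubound S by exists 1 => t [].
have hsS : has_sup S by split => //; exists 0.
set s := sup S.
have s0 : 0 <= s by exact: ub_le_sup ubS _ S0.
have s1 : s <= 1 by apply: ge_sup; [exists 0|move=> t []].
have [d /= d0 near_s] := (nbhs_ballP _ _).1 (lipg s e s0 s1 e0).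
have Ss : S s.
  split => //; have [t St st] := sup_adherent d0 hsS.
  have ts : t <= s by exact: ub_le_sup ubS _ St.
  have gst : `|g t - g s| <= (L + e) * `|t - s|.
    by apply: near_s; rewrite /ball /= ger0_norm; rewrite -/s in st; lra.
  case: St => t0 t1 gt; rewrite distrC (distrC t) ger0_norm ?subr_ge0// in gst.
  have := ler_distD (g t) (g s) (g 0).
  lra.
have [s1'|] := ltP s 1; last first.
  move=> s1'; have s1E : s = 1 by apply/eqP; rewrite eq_le s1 s1'.
  by case: Ss => _ _; rewrite s1E mulr1.
have [x [sx xd x1]] : exists x, [/\ s < x, x < s + d & x <= 1].
  exists (Num.min 1 (s + d / 2)); split.
  - by rewrite lt_min s1'/=; lra.
  - by rewrite gt_min; apply/orP; right; lra.
  - by rewrite ge_min lexx.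
have Sx : S x.
  split => //; first lra.
  have gx : `|g x - g s| <= (L + e) * `|x - s|.
    by apply: near_s; rewrite /ball /= distrC ger0_norm; lra.
  rewrite ger0_norm in gx; last lra.
  case: Ss => _ _ gs.
  have := ler_distD (g s) (g x) (g 0).
  lra.
have := ub_le_sup ubS Sx; rewrite -/s; lra.
Qed.

Lemma pointwise_lipschitz_segment (R : realType) (U V : normedModType R)
    (f : U -> V) (a b : U) (L : R) :
    (forall t e : R, 0 <= t -> t <= 1 -> 0 < e ->
       \forall x \near a + t *: (b - a),
         `|f x - f (a + t *: (b - a))| <= (L + e) * `|x - (a + t *: (b - a))|) ->
  `|f b - f a| <= L * `|b - a|.
Proof.
move=> lipf.
have [->|ab] := eqVneq a b; first by rewrite !subrr !normr0 mulr0.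
have nab : 0 < `|b - a| by rewrite normr_gt0 subr_eq0 eq_sym.
pose g t := f (a + t *: (b - a)).
suff : `|g 1 - g 0| <= L * `|b - a|.
  by rewrite /g scale1r scale0r addr0 [a + _]addrC subrK.
apply: pointwise_lipschitz_unit => t e t0 t1 e0.
have e0' : 0 < e / `|b - a| by rewrite divr_gt0.
have gt : (fun s : R => a + s *: (b - a)) @ t --> a + t *: (b - a).
  by apply: cvgD; [exact: cvg_cst|apply: cvgZr_tmp; exact: cvg_id].
have := gt _ (lipf t _ t0 t1 e0'); rewrite nbhs_simpl /=.
apply: filterS => s /=.
rewrite opprD addrACA subrr add0r -scalerBl normrZ.
suff -> : (L * `|b - a| + e) * `|s - t| =
  (L + e / `|b - a|) * (`|s - t| * `|b - a|) by [].
by field; lra.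
Qed.

Lemma differentiable_remainder (R : realType) (U V : normedModType R)
    (f : U -> V) (u : U) (e : R) : differentiable f u -> 0 < e ->
  \forall x \near u, `|f x - f u - 'd f u (x - u)| <= e * `|x - u|.
Proof.
move=> /diff_locallyP[_ /eqaddoP fu] e0.
have := fu e e0.
have xu : (fun x => x - u) @ u --> (0 : U).
  by rewrite -(subrr u); apply: cvgB; [exact: cvg_id|exact: cvg_cst].
move=> /xu; rewrite nbhs_simpl /=; apply: filterS => x /=.
by rewrite !fctE /= subrK opprD addrA.
Qed.

Lemma op_norm_unit (R : realType) (H : normedModType R) (A : H -> H) (M : R) :
  (op_norm A <= M%:E)%E -> forall v, `|v| <= 1 -> `|A v| <= M.
Proof.
move=> AM v v1; rewrite -lee_fin; apply: le_trans AM.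
by apply: ereal_sup_ubound; exists v.
Qed.

Lemma linear_bound_unit (R : realType) (U V : normedModType R)
    (A : {linear U -> V}) (M : R) :
  (forall v, `|v| <= 1 -> `|A v| <= M) -> forall v, `|A v| <= M * `|v|.
Proof.
move=> AM v; have [->|v0] := eqVneq v 0; first by rewrite linear0 !normr0 mulr0.
have nv : 0 < `|v| by rewrite normr_gt0.
rewrite -ler_pdivrMr// mulrC -[leLHS]ger0_norm ?mulr_ge0 ?invr_ge0//.
have := AM (`|v|^-1 *: v).
rewrite linearZ /= !normrZ !ger0_norm ?mulr_ge0 ?invr_ge0//.
by apply; rewrite mulVf// gt_eqF.
Qed.

Lemma op_norm_linear (R : realType) (H : normedModType R)
    (A : {linear H -> H}) (M : R) :
  (op_norm A <= M%:E)%E -> forall v, `|A v| <= M * `|v|.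
Proof. by move=> /op_norm_unit; exact: linear_bound_unit. Qed.

Lemma sup_op_norm_le (R : realType) (H : normedModType R) (B : set H)
    (A : H -> {linear H -> H}) (M : R) :
  (ereal_sup [set op_norm (A u) | u in B] <= M%:E)%E ->
  forall u, B u -> forall v, `|A u v| <= M * `|v|.
Proof.
move=> AM u Bu; apply: op_norm_linear; apply: le_trans AM.
by apply: ereal_sup_ubound; exists u.
Qed.

Lemma bilin_norm_unit (R : realType) (H : normedModType R)
    (D : {bilinear H -> H -> H}) (M : R) :
  (bilin_norm D <= M%:E)%E ->
  forall s v, `|v| <= 1 -> `|D s v| <= M * `|s|.
Proof.
move=> DM s v v1; have := @linear_bound_unit _ _ _ (applyr D v) M.
apply => {}s s1; apply: op_norm_unit v v1; apply: le_trans DM.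
by apply: ereal_sup_ubound; exists s.
Qed.

(** Subtracting a linear A from F covers at once the Lipschitz bound (A zero) and
    the first-order Taylor bound (A the derivative at a). *)
Lemma mean_value_linear (R : realType) (H : normedModType R) (F : H -> H)
    (A : {linear H -> H}) (a b : H) (M : R) :
  (forall t, 0 <= t -> t <= 1 -> let u := a + t *: (b - a) in
     differentiable F u /\ forall w, `|'d F u w - A w| <= M * `|w|) ->
  `|F b - F a - A (b - a)| <= M * `|b - a|.
Proof.
move=> dF; pose G x := F x - A x.
have -> : F b - F a - A (b - a) = G b - G a.
  by rewrite /G linearB /= !opprD addrACA.
apply: pointwise_lipschitz_segment => t e t0 t1 e0.
have [dFu Mu] := dF t t0 t1.
set u := a + _ in dFu Mu *.
apply: filterS (differentiable_remainder dFu e0) => x dx.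
have -> : G x - G u =
    (F x - F u - 'd F u (x - u)) + ('d F u (x - u) - A (x - u)).
  by rewrite addrA subrK /G (linearB A x u) !opprD addrACA.
apply: le_trans (ler_normD _ _) _; by rewrite addrC mulrDl lerD.
Qed.

(** Since 'd F is differentiable only relatively to B, the segment is required to
    lie in the interior of B; on unit vectors w, the operator norm bound becomes
    a pointwise Lipschitz bound for x |-> 'd F x w. *)
Lemma diff_lipschitz (R : realType) (H : normedModType R) (B : set H)
    (F : H -> H) (a b : H) (M2 : R) : diff2_bounded_on B F M2 ->
    (forall t, 0 <= t -> t <= 1 -> nbhs (a + t *: (b - a)) B) ->
  forall w, `|'d F b w - 'd F a w| <= M2 * `|b - a| * `|w|.
Proof.
move=> [D2 [dD2 D2M]] segB w.
apply: (@linear_bound_unit _ _ _ ('d F b \- 'd F a)) => {}w w1 /=.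
apply: (pointwise_lipschitz_segment (f := fun x => 'd F x w)) => t e t0 t1 e0.
have Bu := segB t t0 t1; set u := a + _ in Bu *.
have uB := nbhs_singleton Bu; have [_ /(_ e e0)] := dD2 u uB.
rewrite nearE /within /= => near_u.
apply: filterS2 Bu near_u => x Bx /(_ Bx)/op_norm_unit/(_ _ w1) dx.
rewrite mulrDl -(subrK (D2 u (x - u) w) ('d F x w - 'd F u w)) addrC.
apply: le_trans (ler_normD _ _) _; rewrite lerD//.
apply: bilin_norm_unit => //; apply: le_trans D2M.
by apply: ereal_sup_ubound; exists u.
Qed.

(** On the segment, 'd F stays within M2 * `|b - a| of 'd F a; the optimal factor
    1/2 is lost, but any constant would do below. *)
Lemma taylor1_bound (R : realType) (H : normedModType R) (B : set H)
    (F : H -> H) (a b : H) (M2 : R) : 0 <= M2 ->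
    (forall u, B u -> differentiable F u) -> diff2_bounded_on B F M2 ->
    (forall t, 0 <= t -> t <= 1 -> nbhs (a + t *: (b - a)) B) ->
  `|F b - F a - 'd F a (b - a)| <= M2 * `|b - a| ^+ 2.
Proof.
move=> M20 dF d2F segB; rewrite expr2 mulrA.
apply: mean_value_linear => t t0 t1 u; split.
  by apply: dF; exact: nbhs_singleton (segB t t0 t1).
have ua : u - a = t *: (b - a) by rewrite /u addrAC subrr add0r.
move=> w; apply: le_trans (diff_lipschitz (b := u) d2F _ w) _.
  move=> s s0 s1; rewrite ua scalerA; apply: segB; first exact: mulr_ge0.
  by rewrite mulr_ile1.
rewrite ua normrZ ger0_norm// ler_wpM2r// ler_wpM2l//.
by rewrite ler_piMl.
Qed.

(** * One Euler step *)

Lemma segment_in_ball (R : realType) (V : normedModType R) (y a b : V) (r : R) :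
  `|a - y| <= r -> `|b - y| <= r ->
  forall t, 0 <= t -> t <= 1 -> `|a + t *: (b - a) - y| <= r.
Proof.
move=> ar br t t0 t1.
have -> : a + t *: (b - a) - y = (1 - t) *: (a - y) + t *: (b - y).
  rewrite scalerBl scale1r -[RHS]addrA -scalerN -scalerDr opprB [y - a + _]addrC.
  by rewrite subrKA addrAC.
apply: le_trans (ler_normD _ _) _; rewrite !normrZ !ger0_norm ?subr_ge0//.
have : (1 - t) * `|a - y| <= (1 - t) * r by rewrite ler_wpM2l// subr_ge0.
have : t * `|b - y| <= t * r by rewrite ler_wpM2l.
lra.
Qed.

(** The inverse function theorem without the inverse: v - y is recovered from
    A (v - y) through G, and the quadratic error is absorbed on the left as soon
    as it is at most half of `|v - y|. *)
Lemma zero_error_bound (R : realType) (H : normedModType R) (F : H -> H)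
    (A G : {linear H -> H}) (y v : H) (m M : R) : 0 <= m ->
    cancel A G -> (forall w, `|G w| <= m * `|w|) ->
    `|F v - F y - A (v - y)| <= M * `|v - y| ^+ 2 ->
    m * M * `|v - y| <= 1 / 2 ->
  `|v - y| <= 2 * m * `|F v - F y|.
Proof.
move=> m0 AG Gm taylor small.
have GA := Gm (A (v - y)); rewrite AG in GA.
have Avy : `|A (v - y)| <= `|F v - F y| + M * `|v - y| ^+ 2.
  rewrite -[A _](subKr (F v - F y)); apply: le_trans (ler_normB _ _) _.
  by rewrite lerD2l.
have mAvy := ler_wpM2l m0 Avy.
have absorbed : m * M * `|v - y| * `|v - y| <= 1 / 2 * `|v - y|.
  by rewrite ler_wpM2r.
nra.
Qed.

(** Expanding the square gives 1 - 2 k h + (M h)^2, which is at most the square of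
    1 - k h + (M h)^2; this form avoids square roots. *)
Lemma dissipative_step (R : realType) (H : normedModType R)
    (dot : {dot H for idfun}) (p q : H) (k M h : R) : induces_norm dot ->
    0 <= h -> k * h <= 1 ->
    dot q p <= - k * `|p| ^+ 2 -> `|q| <= M * `|p| ->
  `|p + h *: q| <= (1 - k * h + (M * h) ^+ 2) * `|p|.
Proof.
move=> dotn h0 kh dqp qM.
have pos : 0 <= (1 - k * h + (M * h) ^+ 2) * `|p|.
  by rewrite mulr_ge0// addr_ge0 ?sqr_ge0// subr_ge0.
rewrite -(ler_pXn2r (n := 2))// ?nnegrE//.
rewrite -dotn hnormD /= !dotn expr0 mul1r hermC expr0 mul1r /= linearZl_LR /=.
rewrite normrZ ger0_norm// !exprMn.
have q2 : `|q| ^+ 2 <= (M * `|p|) ^+ 2.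
  by rewrite ler_pXn2r// nnegrE//; apply: le_trans qM.
have := ler_wpM2l (sqr_ge0 h) q2; have := ler_wpM2l h0 dqp.
rewrite -[M ^+ 2 * _]exprMn; have := sqr_ge0 `|p|; have := sqr_ge0 (M * h).
set X := (M * h) ^+ 2; set P := `|p| ^+ 2 => X0 P0.
have -> : h ^+ 2 * (M * `|p|) ^+ 2 = X * P by rewrite /X /P; ring.
have : (1 - 2 * (k * h) + X) * P <= (1 - k * h + X) ^+ 2 * P.
  rewrite ler_wpM2r// -subr_ge0.
  have -> : (1 - k * h + X) ^+ 2 - (1 - 2 * (k * h) + X) =
      (X - k * h) ^+ 2 + X by ring.
  by rewrite addr_ge0 ?sqr_ge0.
lra.
Qed.

(** Here w = Phi v, p = F v, q = F'(v) w and p' = F (v + h w).  The terms of order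
    h^2 are paid for by lowering the decay rate from c1 to k. *)
Lemma residual_decay (R : realType) (H : normedModType R)
    (dot : {dot H for idfun}) (w p q p' : H) (c1 c2 M1 M2 k h : R) :
    induces_norm dot -> 0 <= h -> 0 <= c2 -> 0 <= M1 -> 0 <= M2 ->
    c1 * h <= 1 -> h * ((M1 * c2) ^+ 2 + M2 * c2 ^+ 2) <= c1 - k ->
    dot q p <= - c1 * `|p| ^+ 2 -> `|w| <= c2 * `|p| -> `|p| <= 1 ->
    `|q| <= M1 * `|w| -> `|p' - p - h *: q| <= M2 * `|h *: w| ^+ 2 ->
  `|p'| <= (1 - k * h) * `|p|.
Proof.
move=> dotn h0 c20 M10 M20 c1h hk dqp wp p1 qw taylor.
have qp : `|q| <= M1 * c2 * `|p|.
  by rewrite -mulrA; apply: le_trans qw _; rewrite ler_wpM2l.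
have step := dissipative_step dotn h0 c1h dqp qp.
have w2 : `|h *: w| ^+ 2 <= h ^+ 2 * c2 ^+ 2 * `|p|.
  rewrite normrZ ger0_norm// exprMn -mulrA ler_wpM2l ?sqr_ge0//.
  apply: (@le_trans _ _ ((c2 * `|p|) ^+ 2)).
    by rewrite ler_pXn2r// nnegrE// mulr_ge0.
  by rewrite exprMn ler_wpM2l ?sqr_ge0// expr2 ler_piMl.
have := ler_wpM2l M20 w2.
have : `|p'| <= `|p + h *: q| + `|p' - p - h *: q|.
  rewrite -[X in `|X| <= _](subrK (p + h *: q)) addrC.
  by apply: le_trans (ler_normD _ _) _; rewrite opprD addrA.
have : h * `|p| * (h * ((M1 * c2) ^+ 2 + M2 * c2 ^+ 2)) <= h * `|p| * (c1 - k).
  by rewrite ler_wpM2l// mulr_ge0.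
rewrite !exprMn in step *.
nra.
Qed.

(** * From decay of the residual to distance *)

(** Here p is a distance to a goal, r a residual, and f moves by at most b * r
    while contracting r by the factor 1 - k: summing the moves b (1 - k)^i r gives
    b / k * r.  The crude bound p <= K * r only serves to discard the remainder
    K (1 - k)^n r, so that K does not appear in the conclusion. *)
Lemma decay_error_bound (R : realType) (T : Type) (S : set T) (f : T -> T)
    (p r : T -> R) (K b k : R) : 0 < k -> k <= 1 ->
    (forall v, S v -> [/\ S (f v), 0 <= r v, p v <= K * r v,
       p v <= p (f v) + b * r v & r (f v) <= (1 - k) * r v]) ->
    0 <= K -> 0 <= b ->
  forall v, S v -> p v <= b / k * r v.
Proof.
move=> k0 k1 HS K0 b0.
have bk0 : 0 <= b / k by rewrite divr_ge0// ltW.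
have q0 : 0 <= 1 - k by rewrite subr_ge0.
have iter n v : S v -> p v <= (b / k + K * (1 - k) ^+ n) * r v.
  elim: n v => [|n IH] v Sv; have [Sfv rv pK pf rf] := HS v Sv.
    rewrite expr0 mulr1 mulrDl; apply: le_trans pK _.
    by rewrite lerDr mulr_ge0.
  apply: le_trans pf _.
  have := IH _ Sfv; have Kn : 0 <= b / k + K * (1 - k) ^+ n.
    by rewrite addr_ge0// mulr_ge0// exprn_ge0.
  have := ler_wpM2l Kn rf.
  have -> : (b / k + K * (1 - k) ^+ n.+1) * r v =
      (b / k + K * (1 - k) ^+ n) * ((1 - k) * r v) + b * r v.
    by rewrite exprS; field; lra.
  lra.
move=> v Sv.
have lim : (b / k + K * (1 - k) ^+ n) * r v @[n --> \oo] -->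
    (b / k + K * 0) * r v.
  apply: cvgM; last exact: cvg_cst.
  apply: cvgD; first exact: cvg_cst.
  apply: cvgM; first exact: cvg_cst.
  by apply: cvg_expr; rewrite ger0_norm//; lra.
rewrite -[b / k]addr0 -(mulr0 K) -(cvg_lim _ lim)//;
  apply: limr_ge; first by apply/cvg_ex; eexists; exact: lim.
by near=> n; exact: iter.
Unshelve. all: by end_near. Qed.

Theorem theorem7p1 (R : realType) (H : completeNormedModType R)
    (dot : {dot H for idfun}) (dot_norm : induces_norm dot)
    (F Phi : H -> H) (Phi_lip : locally_lipschitz Phi)
    (y : H) (Fy0 : F y = 0)
    (rho M1 M2 m1 c1 c2 L1 : R)
    (rho_gt0 : 0 < rho) (M1_gt0 : 0 < M1) (M2_gt0 : 0 < M2) (m1_gt0 : 0 < m1)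
    (c1_gt0 : 0 < c1) (c2_gt0 : 0 < c2) (L1_gt0 : 0 < L1)
    (c : R) (c_gt0 : 0 < c) (c_lt : c < c1) :
  exists eta h0 : R, [/\ 0 < eta, 0 < h0 &
    forall (h : R) (u0 : H), 0 < h -> h <= h0 -> `|u0 - y| <= eta ->
      let B := @closed_ball_ R H Num.norm in
      B u0 rho y ->
      diff_bounded_on (B u0 rho) F M1 ->
      diff2_bounded_on (B u0 rho) F M2 ->
      diff_inverse_bounded_on (B u0 rho) F m1 ->
      (forall u : H, B u0 rho u ->
         dot ('d F u (Phi u)) (F u) <= - c1 * `|F u| ^+ 2 /\
         `|Phi u| <= c2 * `|F u|) ->
      c2 / c1 * `|F u0| <= rho ->
      diff_bounded_on (B y rho) Phi L1 ->
      forall n : nat,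
        `|euler Phi h u0 n - y|
           <= c2 * `|F u0| / c1 * expR (- (c * h * n%:R)) /\
        `|F (euler Phi h u0 n)| <= `|F u0| * expR (- (c * h * n%:R))].
Proof.
(* The ball of radius 2 delta about y lies inside B u0 rho with a margin delta,
   and delta is small enough for the quadratic error of Taylor's formula. *)
pose delta := Num.min (rho / 4) (1 / (4 * m1 * M2)).
(* 2 m1 eps <= delta sends points of residual at most eps back into S below. *)
pose eps := Num.min 1 (delta / (2 * m1)).
pose C := (M1 * c2) ^+ 2 + M2 * c2 ^+ 2.
(* The three bounds absorb the second-order terms, keep 1 - c1 h nonnegative, and
   keep an Euler step from S within 2 delta of y, in this order. *)
pose step k := Num.min ((c1 - k) / C) (Num.min (1 / c1) (delta / c2)).
have delta0 : 0 < delta by rewrite lt_min !divr_gt0// !mulr_gt0.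
have eps0 : 0 < eps by rewrite lt_min ltr01 divr_gt0// mulr_gt0.
have C0 : 0 < C by rewrite addr_gt0// ?mulr_gt0// exprn_gt0// mulr_gt0.
have step0 (k : R) : k < c1 -> 0 < step k.
  by move=> kc; rewrite !lt_min !divr_gt0// subr_gt0.
have delta_rho : 4 * delta <= rho.
  have : delta <= rho / 4 by rewrite ge_min lexx.
  lra.
have delta_m : m1 * M2 * (2 * delta) <= 1 / 2.
  have : delta <= 1 / (4 * m1 * M2) by rewrite ge_min lexx orbT.
  rewrite ler_pdivlMr ?mulr_gt0//; lra.
have eps1 : eps <= 1 by rewrite ge_min lexx.
have eps_delta : 2 * m1 * eps <= delta.
  have : eps <= delta / (2 * m1) by rewrite ge_min lexx orbT.
  rewrite ler_pdivlMr ?mulr_gt0//; lra.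
have stepP (k h : R) : h <= step k ->
    [/\ h * C <= c1 - k, c1 * h <= 1 & h * c2 <= delta].
  rewrite le_min => /andP[hC]; rewrite le_min => /andP[hc1 hc2].
  by split; rewrite ?[c1 * h]mulrC -ler_pdivlMr.
exists (Num.min delta (eps / M1)), (step c); split; [|exact: step0|].
  by rewrite lt_min delta0 divr_gt0.
move=> h u0 h_gt0 h_le; rewrite le_min ler_pdivlMr// mulrC => /andP[u0d u0e] B.
move=> _ [dF dFM1] d2F [G [GF GM]] cond _ _.
have B_nbhs v : `|v - y| <= 2 * delta -> nbhs v (B u0 rho).
  move=> vy; apply/nbhs_ballP; exists delta => //= x; rewrite -ball_normE /= => vx.
  rewrite /B /closed_ball_ /=.
  have := ler_distD v u0 x; have := ler_distD y u0 v.
  by rewrite (distrC y v); lra.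
have B_near v : `|v - y| <= 2 * delta -> B u0 rho v.
  by move=> /B_nbhs/nbhs_singleton.
have d_le : delta <= 2 * delta by lra.
have taylor a b : `|a - y| <= 2 * delta -> `|b - y| <= 2 * delta ->
    `|F b - F a - 'd F a (b - a)| <= M2 * `|b - a| ^+ 2.
  move=> ay bY; apply: taylor1_bound dF d2F _; first exact: ltW.
  by move=> t t0 t1; apply: B_nbhs; exact: segment_in_ball.
have coarse v : `|v - y| <= 2 * delta -> `|v - y| <= 2 * m1 * `|F v|.
  move=> vy; have yy : `|y - y| <= 2 * delta by rewrite subrr normr0; lra.
  rewrite -[F v]subr0 -Fy0.
  apply: (zero_error_bound (A := 'd F y) (G := G y) (M := M2)).
  - exact: ltW.
  - exact: (GF _ (B_near y yy)).1.
  - by apply: sup_op_norm_le GM _ _; exact: B_near.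
  - exact: taylor.
  - by apply: le_trans delta_m; rewrite ler_wpM2l// mulr_ge0// ltW.
pose S := [set v | `|v - y| <= delta /\ `|F v| <= eps].
have euler_step (k h' : R) v : 0 < h' -> h' <= step k -> 0 < k -> k < c1 ->
    S v -> S (v + h' *: Phi v) /\ `|F (v + h' *: Phi v)| <= (1 - k * h') * `|F v|.
  move=> h'0 /stepP[h'C h'c1 h'c2] k0 kc1 [vy vF].
  have vy2 := le_trans vy d_le.
  have vF1 := le_trans vF eps1.
  have [dis Phile] := cond v (B_near v vy2).
  have hPhi : `|h' *: Phi v| <= delta.
    rewrite normrZ gtr0_norm//; apply: le_trans h'c2.
    rewrite ler_wpM2l ?(ltW h'0)//.
    by apply: le_trans Phile _; rewrite ler_piMr// ltW.
  have v'y2 : `|v + h' *: Phi v - y| <= 2 * delta.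
    by rewrite addrAC; apply: le_trans (ler_normD _ _) _; lra.
  have decay : `|F (v + h' *: Phi v)| <= (1 - k * h') * `|F v|.
    apply: (@residual_decay _ _ dot (Phi v) _ ('d F v (Phi v)) _ c1 c2 M1 M2) => //.
    all: try exact: ltW.
    - by apply: sup_op_norm_le dFM1 _ _ _; exact: B_near.
    - have := taylor v _ vy2 v'y2.
      by rewrite [v + _]addrC addrK linearZ.
  have kh'0 : 0 <= k * h' by rewrite mulr_ge0// ltW.
  have v'F : `|F (v + h' *: Phi v)| <= eps.
    apply: le_trans decay _; apply: le_trans vF.
    by rewrite ler_piMl//; lra.
  split=> //; split=> //; apply: le_trans (coarse _ v'y2) _.
  by apply: le_trans eps_delta; rewrite ler_wpM2l// mulr_ge0// ltW.
(* The auxiliary step length is step k, unrelated to h. *)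
have sharp v : S v -> `|v - y| <= c2 / c1 * `|F v|.
  move=> Sv.
  have bound (k : R) : 0 < k -> k < c1 -> `|v - y| <= c2 / k * `|F v|.
    move=> k0 kc; have h'0 := step0 k kc.
    have [_ h'c1 _] := stepP k _ (lexx (step k)).
    have -> : c2 / k = (step k * c2) / (k * step k).
      by rewrite [step k * c2]mulrC -mulf_div divff ?gt_eqF// mulr1.
    apply: (@decay_error_bound R H S (fun x => x + step k *: Phi x)
      (fun x => `|x - y|) (fun x => `|F x|) (2 * m1)) Sv.
    - exact: mulr_gt0.
    - by apply: le_trans h'c1; rewrite ler_wpM2r// ltW.
    - move=> x Sx; have [Sx' Fx'] := euler_step k _ x h'0 (lexx (step k)) k0 kc Sx.
      have xy2 := le_trans Sx.1 d_le.
      split => //; first exact: coarse.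
      rewrite -[x - y](addrK (step k *: Phi x)) [x - y + _]addrAC.
      apply: le_trans (ler_normB _ _) _; rewrite lerD2l normrZ gtr0_norm//.
      by rewrite -mulrA ler_wpM2l ?(ltW h'0)//; exact: (cond x (B_near x xy2)).2.
    - by rewrite mulr_ge0// ltW.
    - by rewrite mulr_ge0// ltW.
  rewrite mulrAC ler_pdivlMr// leNgt; apply/negP => lt_c1.
  have Fv0 : 0 <= c2 * `|F v| by rewrite mulr_ge0// ltW.
  have vy0 : 0 < `|v - y|
    by rewrite -(pmulr_lgt0 _ c1_gt0); exact: le_lt_trans Fv0 lt_c1.
  (* If the bound failed, it would fail already for some k < c1: the midpoint of
     c1 and the quotient that it exceeds. *)
  pose k := (c1 + c2 * `|F v| / `|v - y|) / 2.
  have quot0 : 0 <= c2 * `|F v| / `|v - y| by rewrite divr_ge0.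
  have quot1 : c2 * `|F v| / `|v - y| < c1.
    by rewrite ltr_pdivrMr// [c1 * _]mulrC.
  have k0 : 0 < k by rewrite /k; lra.
  have := bound k k0 ltac:(rewrite /k; lra).
  rewrite mulrAC ler_pdivlMr// leNgt => /negP; apply.
  by rewrite [_ * k]mulrC -ltr_pdivrMr// /k; lra.
have Su0 : S u0.
  split => //.
  have := @mean_value_linear _ _ F \0 y u0 M1; rewrite Fy0 !subr0.
  move=> mv; apply: le_trans u0e; apply: mv => t t0 t1 u.
  have Bu : B u0 rho u.
    apply: B_near; apply: segment_in_ball => //; first by rewrite subrr normr0; lra.
    exact: le_trans d_le.
  split; first exact: dF.
  by move=> w; rewrite subr0; exact: sup_op_norm_le dFM1 _ Bu w.
have orbit n : S (euler Phi h u0 n) /\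
    `|F (euler Phi h u0 n)| <= `|F u0| * expR (- (c * h * n%:R)).
  elim: n => [|n [Sn Fn]] /=; first by rewrite mulr0 oppr0 expR0 mulr1.
  have [Sn' Fn'] := euler_step c h _ h_gt0 h_le c_gt0 c_lt Sn; split => //.
  apply: le_trans Fn' _.
  have -> : - (c * h * n.+1%:R) = - (c * h) + - (c * h * n%:R).
    by rewrite -natr1; ring.
  rewrite expRD mulrCA; apply: ler_pM => //.
    have [_ c1h _] := stepP c h h_le.
    have : c * h <= c1 * h by rewrite ler_pM2r// ltW.
    lra.
  exact: expR_ge1Dx.
move=> n; have [Sn Fn] := orbit n; split => //.
apply: le_trans (sharp _ Sn) _.
have -> : c2 * `|F u0| / c1 = c2 / c1 * `|F u0| by ring.
by rewrite -[leRHS]mulrA ler_wpM2l// divr_ge0// ltW.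
Qed.
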